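(* Let $S$ be a differential algebra over $\mathbb{Q}$ with no zero divisors and let $b$ be a non-zero element of $S$. Let $R$ be a differential subalgebra of $S$ over which $S$ is differentially finitely generated. Let $\mathcal{F}$ be a differentially closed field of characteristic $0$. Then there exists a non-zero element $a$ of $R$ such that every homomorphism of differential algebras $\varphi : R \to \mathcal{F}$ with $\varphi(a) \neq 0$ extends to a homomorphism of differential algebras $\psi : S \to \mathcal{F}$ with $\psi(b) \neq 0$.
   Context: All algebras are commutative, associative and unital. A differential algebra is an algebra over a field equipped with a fixed derivation $\delta$ (a single derivation); a differential field is a field with a fixed derivation. Homomorphisms of differential algebras are (unital) algebra homomorphisms commuting with the derivations; differential subalgebras are $\delta$-stable subalgebras, with the restricted derivation. A differential algebra $S$ is differentially generated by $x_1,\dots,x_n$ over a differential subalgebra $R$ (written $S=R\{x_1,\dots,x_n\}$) if the algebra $S$ is generated by $R$ together with all derivatives $x_i^{(k)}=\delta^k x_i$, $1\le i\le n$, $k\ge 0$; $S$ is differentially finitely generated over $R$ if such a finite family exists. For a differential field $\mathcal{F}$, $\mathcal{F}\{y\}$ is the algebra of differential polynomials, i.e. the polynomial algebra $\mathcal{F}[y^{(k)}, k\ge 0]$ (with $y=y^{(0)}$) with the derivation extending that of $\mathcal{F}$ and satisfying $\delta(y^{(k)})=y^{(k+1)}$. For $A\in\mathcal{F}\{y\}$ and $\alpha\in\mathcal{F}$, $A(\alpha)$ is obtained by substituting $\delta^k\alpha$ for $y^{(k)}$ for all $k$. For $A\in \mathcal{F}\{y\}\setminus\mathcal{F}$ the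 order $\mathrm{ord}\,A$ is the largest $r$ such that $y^{(r)}$ is present in $A$; elements of $\mathcal{F}$ are regarded as having order $-\infty$, less than the order of any element of $\mathcal{F}\{y\}\setminus\mathcal{F}$. A differential field $\mathcal{F}$ is called differentially closed if for any $A,B\in\mathcal{F}\{y\}$ with $B\ne 0$ and $\mathrm{ord}\,B<\mathrm{ord}\,A$ there exists $\alpha\in\mathcal{F}$ such that $A(\alpha)=0$ and $B(\alpha)\neq 0$. *)

(* Defs.v *)
From HB Require Import structures.
From mathcomp Require Import all_boot all_order all_algebra.
From mathcomp Require Import finmap.
From mathcomp.multinomials Require Import monalg.

Set Implicit Arguments.
Unset Strict Implicit.
Unset Printing Implicit Defensive.

Import GRing.Theory.
Local Open Scope ring_scope.

HB.mixin Record hasDerivation A of GRing.ComNzRing A := {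
  delta : A -> A;
  deltaD : {morph delta : x y / x + y};
  deltaM : forall x y, delta (x * y) = delta x * y + x * delta y
}.

#[short(type="diffRingType")]
HB.structure Definition DiffRing := {A of GRing.ComNzRing A & hasDerivation A}.

(* Q-linearity of [delta] need not be required: additivity implies it. *)
#[short(type="diffAlgQType")]
HB.structure Definition DiffAlgQ :=
  {A of GRing.ComAlgebra rat A & hasDerivation A}.

#[short(type="diffFieldType")]
HB.structure Definition DiffField := {F of GRing.Field F & hasDerivation F}.

HB.mixin Record isDeltaClosed (A : diffAlgQType) (R : {pred A}) := {
  delta_closed : {in R, forall x, delta x \in R}
}.

#[short(type="diffSubalg")]
HB.structure Definition DiffSubalg (A : diffAlgQType) :=
  {R of @GRing.SubalgClosed rat A R & isDeltaClosed A R}.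

Section DiffSubalgType.
Variables (A : diffAlgQType) (R : diffSubalg A).

Definition dsub : Type := {x : A | x \in R}.

HB.instance Definition _ := [isSub of dsub for sval].
HB.instance Definition _ := [Choice of dsub by <:].
HB.instance Definition _ := [SubChoice_isSubAlgebra of dsub by <:].
HB.instance Definition _ := [SubNzRing_isSubComNzRing of dsub by <:].

Definition dsub_delta (x : dsub) : dsub :=
  exist _ (delta (val x)) (delta_closed (val x) (valP x)).

Fact dsub_deltaD : {morph dsub_delta : x y / x + y}.
Proof. by move=> x y; apply: val_inj; rewrite /= deltaD. Qed.

Fact dsub_deltaM x y :
  dsub_delta (x * y) = dsub_delta x * y + x * dsub_delta y.
Proof. by apply: val_inj; rewrite /= deltaM. Qed.

HB.instance Definition _ := hasDerivation.Build dsub dsub_deltaD dsub_deltaM.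
End DiffSubalgType.

Inductive subalg_gen (k : pzRingType) (A : algType k) (X : A -> Prop) :
    A -> Prop :=
| subalg_gen_mem x : X x -> subalg_gen X x
| subalg_gen_one : subalg_gen X 1
| subalg_gen_lin c x y :
    subalg_gen X x -> subalg_gen X y -> subalg_gen X (c *: x + y)
| subalg_gen_mul x y :
    subalg_gen X x -> subalg_gen X y -> subalg_gen X (x * y).

Definition diff_generated (S : diffAlgQType) (R : diffSubalg S)
    (n : nat) (x : 'I_n -> S) : Prop :=
  forall s : S,
    subalg_gen (fun t => t \in R \/ exists i k, t = iter k delta (x i)) s.

Definition diff_finitely_generated (S : diffAlgQType) (R : diffSubalg S) :=
  exists (n : nat) (x : 'I_n -> S), diff_generated R x.

(* A differential field of characteristic 0 is a Q-algebra through [ratr]. *)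
Definition diff_hom (A : diffAlgQType) (F : diffFieldType) (f : A -> F) :=
  [/\ {morph f : x y / x + y},
      monoid_morphism f,
      forall (q : rat) (x : A), f (q *: x) = ratr q * f x
    & {morph f : x / delta x}].

(* F{y}, as an algebra: the variable k : nat stands for y^(k), and a monomial
   m : {cmonom nat} has exponent m k in y^(k).  Neither [dord] nor [deval]
   involves the derivation of F{y}, which is therefore not constructed. *)
Notation "{ 'dpoly' F }" := {malg F[{cmonom nat}]}
  (at level 0, F at level 2, format "{ 'dpoly'  F }") : type_scope.

(* [None] stands for -oo, the order of the elements of F. *)
Definition dord (F : diffFieldType) (A : {dpoly F}) : option nat :=
  let vars := [seq r | m : {cmonom nat} <- msupp A, r <- finsupp m] in
  if vars is [::] then None else Some (\max_(r <- vars) r)%N.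

Definition dord_lt (o1 o2 : option nat) : bool :=
  match o1, o2 with
  | _, None => false
  | None, Some _ => true
  | Some r1, Some r2 => (r1 < r2)%N
  end.

Definition deval (F : diffFieldType) (A : {dpoly F}) (alpha : F) : F :=
  mmap idfun (fun m : {cmonom nat} =>
    \prod_(k <- finsupp m) iter k delta alpha ^+ m k) A.

Definition differentially_closed (F : diffFieldType) : Prop :=
  forall A B : {dpoly F}, B != 0 -> dord_lt (dord B) (dord A) ->
    exists alpha : F, deval A alpha = 0 /\ deval B alpha != 0.

(* Main.v *)
From HB Require Import structures.
Require Import Defs.
From mathcomp Require Import all_boot all_order all_algebra.
From mathcomp Require Import finmap.
From mathcomp.multinomials Require Import monalg.
From mathcomp Require Import boolp.

Set Implicit Arguments.
Unset Strict Implicit.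
Unset Printing Implicit Defensive.

Import GRing.Theory.
Local Open Scope ring_scope.

(** The generators are adjoined one at a time, the element obtained for one of
    them playing the role of [b] for the previous one; so let [S = R{x}].  Write
    [K r] for the subring of [S] generated by [R] and the derivatives [x^(i)],
    [i < r].  The map [phi : R -> F] extends with value [alpha] at [x] exactly
    when the differential subring of [S * F] generated by the pairs
    [(c, phi c)] and by [(x, alpha)] is the graph of a function.  So everything
    comes down to choosing [alpha] so that in this subring [(0, t)] forces
    [t = 0], and [(b, t)] forces [t != 0].

    As long as the [x^(i)], [i < r], are algebraically independent over [R], the
    same graph with differential indeterminates in place of the [alpha^(i)],
    living in [S * F{y}], is the graph of a function on [K r] whatever [phi]
    ([graph_inj]); and a non-zero [D] in [K r] goes to a non-zero differential
    polynomial as soon as [phi] does not kill one coefficient of [D], which lies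
    in [R] ([generic_specialization]).

    If all the [x^(i)] are independent, [alpha] has only to avoid the zeros of
    the polynomial attached to [b], and this is an instance of differential
    closedness ([transcendental_step]).

    Otherwise let [r] be least such that [x^(r)] is algebraic over [K r], let
    [p] be a polynomial over [K r] of least degree with [p(x^(r)) = 0], and let
    [s = p'(x^(r))] be its separant, which is non-zero in characteristic zero.
    Differentiating [p(x^(r)) = 0] expresses [s * x^(r+1)] through lower
    derivatives, so that a power of [s] carries any element of [S] into [K r.+1]
    ([separant_reduction]); pseudo-division by [p] then brings the degree in
    [x^(r)] below that of [p], where a vanishing value forces vanishing
    coefficients by minimality.  The same reductions hold in the graph, provided
    the values at [alpha] of the leading coefficient of [p] and of [s] are
    non-zero.  Finally, [x^(r)] being algebraic, each of [s] and [s ^+ N * b] has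
    a non-zero multiple in [K r] ([adj_dvd]).  Hence it suffices that [alpha] be
    a zero of the image of [p], of order [r], at which the image of one non-zero
    element of [K r], of order less than [r], does not vanish: this is exactly
    what differential closedness provides ([algebraic_step]). *)

(** * Rings generated by a base and finitely many elements *)

Inductive ring_gen (W : pzRingType) (X : W -> Prop) : W -> Prop :=
| ring_gen_mem w : X w -> ring_gen X w
| ring_gen1 : ring_gen X 1
| ring_genB v w : ring_gen X v -> ring_gen X w -> ring_gen X (v - w)
| ring_genM v w : ring_gen X v -> ring_gen X w -> ring_gen X (v * w).

(** The ring obtained from [T] by adjoining the first [k] terms of [z].  It is a
    boolean predicate so that the closure lemmas on [rpred] and [polyOver] apply
    to it. *)
Definition adj (W : pzRingType) (T : W -> Prop) (z : nat -> W) (k : nat) :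
    {pred W} :=
  fun w => `[< ring_gen (fun v => T v \/ exists2 i, (i < k)%N & v = z i) w >].

Section Adjunction.
Variables (W : pzRingType) (T : W -> Prop) (z : nat -> W) (k : nat).

Fact adj_subring : subring_closed (adj T z k).
Proof.
split; first by apply/asboolP; exact: ring_gen1.
- by move=> v w /asboolP vA /asboolP wA; apply/asboolP; exact: ring_genB.
- by move=> v w /asboolP vA /asboolP wA; apply/asboolP; exact: ring_genM.
Qed.

HB.instance Definition _ :=
  GRing.isSubringClosed.Build W (adj T z k) adj_subring.

Lemma mem_adj_base w : T w -> w \in adj T z k.
Proof. by move=> Tw; apply/asboolP/ring_gen_mem; left. Qed.

Lemma mem_adj_var i : (i < k)%N -> z i \in adj T z k.
Proof. by move=> ik; apply/asboolP/ring_gen_mem; right; exists i. Qed.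

Lemma adj_ind (L : W -> Prop) :
    (forall w, T w -> L w) -> (forall i, (i < k)%N -> L (z i)) -> L 1 ->
    (forall v w, L v -> L w -> L (v - w)) ->
    (forall v w, L v -> L w -> L (v * w)) ->
  forall w, w \in adj T z k -> L w.
Proof.
move=> LT Lz L1 LB LM w /asboolP; elim=> [v [/LT //|[i ik ->]]||v u _ Lv _ Lu|].
- exact: Lz.
- exact: L1.
- exact: LB.
- by move=> v u _ Lv _ Lu; exact: LM.
Qed.

Lemma adj_sub (K : subringClosed W) :
    (forall w, T w -> w \in K) -> (forall i, (i < k)%N -> z i \in K) ->
  {subset adj T z k <= K}.
Proof.
move=> TK zK w; apply: (adj_ind (L := fun w => w \in K)) => //.
- exact: rpred1.
- exact: rpredB.
- exact: rpredM.
Qed.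

End Adjunction.

Lemma adj_le (W : pzRingType) (T : W -> Prop) (z : nat -> W) j k :
  (j <= k)%N -> {subset adj T z j <= adj T z k}.
Proof.
move=> jk; apply: adj_sub => [w|i ij]; first exact: mem_adj_base.
exact/mem_adj_var/(leq_trans ij).
Qed.

(** Reduces questions on [k.+1] adjoined elements to univariate polynomials over
    the ring with [k] of them. *)
Lemma adjSP (W : comNzRingType) (T : W -> Prop) (z : nat -> W) k w :
  w \in adj T z k.+1 -> exists2 q, q \is a polyOver (adj T z k) & w = q.[z k].
Proof.
pose L w := exists2 q, q \is a polyOver (adj T z k) & w = q.[z k].
apply: (adj_ind (L := L)) => {w}
  [w Tw|i||v w [p pK ->] [q qK ->]|v w [p pK ->] [q qK ->]].
- by exists w%:P; rewrite ?hornerC // polyOverC mem_adj_base.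
- rewrite ltnS leq_eqVlt => /orP[/eqP->|ik].
    by exists 'X; rewrite ?hornerX ?polyOverX.
  by exists (z i)%:P; rewrite ?hornerC // polyOverC mem_adj_var.
- by exists 1; rewrite ?hornerC ?rpred1.
- by exists (p - q); rewrite ?hornerD ?hornerN ?rpredB.
- by exists (p * q); rewrite ?hornerM ?rpredM.
Qed.

Lemma adj_map (V W : pzRingType) (f : {rmorphism V -> W}) (T : V -> Prop)
    (T' : W -> Prop) (z : nat -> V) (z' : nat -> W) k :
    (forall v, T v -> T' (f v)) -> (forall i, f (z i) = z' i) ->
  forall v, v \in adj T z k -> f v \in adj T' z' k.
Proof.
move=> fT fz v; apply: (adj_ind (L := fun v => f v \in adj T' z' k)).
- by move=> w /fT /mem_adj_base.
- by move=> i ik; rewrite fz mem_adj_var.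
- by rewrite rmorph1 rpred1.
- by move=> a b fa fb; rewrite rmorphB rpredB.
- by move=> a b fa fb; rewrite rmorphM rpredM.
Qed.

Lemma adj_lift (V W : pzRingType) (f : {rmorphism V -> W}) (T : V -> Prop)
    (T' : W -> Prop) (z : nat -> V) (z' : nat -> W) k :
    (forall w, T' w -> exists2 v, T v & f v = w) ->
    (forall i, f (z i) = z' i) ->
  forall w, w \in adj T' z' k -> exists2 v, v \in adj T z k & f v = w.
Proof.
move=> fT fz; pose L w := exists2 v, v \in adj T z k & f v = w.
apply: (adj_ind (L := L)).
- by move=> w /fT[v Tv <-]; exists v; rewrite ?mem_adj_base.
- by move=> i ik; exists (z i); rewrite ?mem_adj_var.
- by exists 1; rewrite ?rmorph1 ?rpred1.
- by move=> _ _ [a aK <-] [b bK <-]; exists (a - b); rewrite ?rmorphB ?rpredB.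
- by move=> _ _ [a aK <-] [b bK <-]; exists (a * b); rewrite ?rmorphM ?rpredM.
Qed.

Lemma polyOver_lift (V W : nzRingType) (f : {rmorphism V -> W})
    (K : subringClosed V) (K' : subringClosed W) :
    (forall w, w \in K' -> exists2 v, v \in K & f v = w) ->
  forall p : {poly W}, p \is a polyOver K' ->
    exists2 q : {poly V}, q \is a polyOver K & map_poly f q = p.
Proof.
move=> fK p /polyOverP pK.
have /choice[c cP] i : exists v, v \in K /\ f v = p`_i.
  by have [v vK fv] := fK _ (pK i); exists v.
exists (\poly_(i < size p) c i).
  apply/polyOverP => i; rewrite coef_poly; case: ifP => _; last exact: rpred0.
  by case: (cP i).
apply/polyP => i; rewrite coef_map coef_poly; case: ltnP => [_|le_p].
  by case: (cP i).
by rewrite nth_default ?raddf0.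
Qed.

(** The quotient and the remainder stay over [K] because the algorithm multiplies
    by the leading coefficient of [P] instead of dividing by it. *)
Lemma pseudo_division (W : comNzRingType) (K : subringClosed W)
    (P q : {poly W}) :
    P != 0 -> P \is a polyOver K -> q \is a polyOver K ->
  exists N u rho, [/\ u \is a polyOver K, rho \is a polyOver K,
    lead_coef P ^+ N *: q = u * P + rho & (size rho < size P)%N].
Proof.
move=> P0 PK qK.
suff [uK rK]: Pdiv.CommonRing.rdivp q P \is a polyOver K
    /\ Pdiv.CommonRing.rmodp q P \is a polyOver K.
  exists (Pdiv.CommonRing.rscalp q P), (Pdiv.CommonRing.rdivp q P),
    (Pdiv.CommonRing.rmodp q P); split=> //; last first.
    exact: Pdiv.CommonRing.ltn_rmodpN0.
  exact: Pdiv.ComRing.rdivp_eq.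
have coefK (p : {poly W}) i : p \is a polyOver K -> p`_i \in K.
  by move/polyOverP; exact.
have lK (p : {poly W}) : p \is a polyOver K -> lead_coef p \in K.
  by rewrite lead_coefE; exact: coefK.
suff rec n k (u r : {poly W}) : u \is a polyOver K -> r \is a polyOver K ->
    let d := Pdiv.CommonRing.redivp_rec P k u r n in
    d.1.2 \is a polyOver K /\ d.2 \is a polyOver K.
  rewrite /Pdiv.CommonRing.rdivp /Pdiv.CommonRing.rmodp.
  rewrite /Pdiv.CommonRing.redivp locked_withE.
  rewrite /Pdiv.CommonRing.redivp_expanded_def (negPf P0).
  by apply: rec; rewrite ?rpred0.
elim: n k u r => [|n IH] k u r uK rK /=; case: ifP => _ //=;
  [split | apply: IH];
  by rewrite ?rpredB ?rpredD ?rpredM ?polyOverZ ?polyOverC ?polyOverXn ?lK.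
Qed.

(** * Derivations and reduction by the separant *)

Section Derivation.
Variable W : diffRingType.

Fact delta_zmod_morphism : zmod_morphism (@delta W).
Proof.
have d0 : delta (0 : W) = 0 by apply: (addrI (delta 0)); rewrite -deltaD !addr0.
move=> v w; rewrite deltaD; congr (_ + _).
by apply: (addrI (delta w)); rewrite -deltaD !subrr.
Qed.

HB.instance Definition _ :=
  GRing.isZmodMorphism.Build W W (@delta W) delta_zmod_morphism.

Lemma delta1 : delta (1 : W) = 0.
Proof.
by apply: (addrI (delta 1)); rewrite addr0 -{3}[1]mulr1 deltaM mulr1 mul1r.
Qed.

(** The power rule, multiplied by [w] in order to avoid the exponent [n.-1]. *)
Lemma deltaX (w : W) n : w * delta (w ^+ n) = (w ^+ n * delta w) *+ n.
Proof.
elim: n => [|n IH]; first by rewrite expr0 delta1 mulr0 mulr0n.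
rewrite exprS deltaM mulrDr IH mulrS mulrnAr; congr (_ + _); last first.
  by rewrite mulrA.
by rewrite [delta w * _]mulrC mulrA.
Qed.

Definition derivatives (x : W) (i : nat) : W := iter i delta x.

(** The chain rule.  The term [q] is the value at [z] of the polynomial obtained
    by differentiating the coefficients of [p]. *)
Lemma delta_horner (K K' : subringClosed W) (z : W) :
    {subset K <= K'} -> {in K, forall w, delta w \in K'} -> z \in K' ->
  forall p, p \is a polyOver K ->
    exists2 q, q \in K' & delta p.[z] = q + p^`().[z] * delta z.
Proof.
move=> KK' dK zK' p; elim/poly_ind: p => [|p c IH] pK.
  by exists 0; rewrite ?rpred0 // deriv0 !horner0 raddf0 mul0r addr0.
have cK : c \in K.
  by move/polyOverP: pK => /(_ 0%N); rewrite coefD coefMX coefC add0r.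
have {}pK : p \is a polyOver K.
  apply/polyOverP => i; move/polyOverP: pK => /(_ i.+1).
  by rewrite coefD coefMX coefC addr0.
have [q qK' dp] := IH pK; exists (q * z + delta c).
  by rewrite rpredD ?rpredM ?dK.
rewrite derivD derivM derivX derivC addr0 mulr1 !hornerE deltaD deltaM dp.
rewrite !mulrDl -!addrA; congr (_ + _); rewrite [RHS]addrC -addrA.
by rewrite mulrAC addrA.
Qed.

Variables (T : W -> Prop) (x : W).
Hypothesis deltaT : forall w, T w -> T (delta w).
Local Notation K := (adj T (derivatives x)).

Lemma delta_adj k w : w \in K k -> delta w \in K k.+1.
Proof.
have le := adj_le (T := T) (z := derivatives x) (leqnSn k).
move=> wK; pose L v := v \in K k /\ delta v \in K k.+1.
suff: L w by case.
move: wK; apply: (adj_ind (L := L)) => {w}.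
- by move=> w Tw; split; apply: mem_adj_base; last exact: deltaT.
- move=> i ik; split; first exact: mem_adj_var.
  exact: (@mem_adj_var _ _ _ _ i.+1).
- by split; rewrite ?rpred1 // delta1 rpred0.
- by move=> v w [vK dv] [wK dw]; split; rewrite ?raddfB ?rpredB.
- move=> v w [vK dv] [wK dw]; split; first exact: rpredM.
  by rewrite deltaM; apply: rpredD; apply: rpredM => //; exact: le.
Qed.

Section Separant.
Variables (r : nat) (p : {poly W}).
Hypotheses (pK : p \is a polyOver (K r)) (px0 : p.[derivatives x r] = 0).
Let s := p^`().[derivatives x r].
Let reducible w := exists N, s ^+ N * w \in K r.+1.

Let sK : s \in K r.+1.
Proof.
apply: rpred_horner; last exact: mem_adj_var.
apply: (polyOverS (adj_le (leqnSn r))); exact: polyOver_deriv.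
Qed.

Let redK w : w \in K r.+1 -> reducible w.
Proof. by exists 0%N; rewrite mul1r. Qed.

Let red_le w N M : (N <= M)%N -> s ^+ N * w \in K r.+1 -> s ^+ M * w \in K r.+1.
Proof. by move=> /subnK <- wK; rewrite exprD -mulrA rpredM ?rpredX. Qed.

Let redB v w : reducible v -> reducible w -> reducible (v - w).
Proof.
move=> [N vK] [M wK]; exists (N + M)%N; rewrite mulrBr rpredB //.
  exact: (red_le (leq_addr _ _) vK).
exact: (red_le (leq_addl _ _) wK).
Qed.

Let redM v w : reducible v -> reducible w -> reducible (v * w).
Proof.
by move=> [N vK] [M wK]; exists (N + M)%N; rewrite exprD mulrACA rpredM.
Qed.

Let red1 : reducible 1.
Proof. exact/redK/rpred1. Qed.

Let red_next : reducible (derivatives x r.+1).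
Proof.
exists 1%N; rewrite expr1.
have [|||q qK dp] :=
  @delta_horner (K r) (K r.+1) (derivatives x r) _ _ _ p pK.
- exact/adj_le.
- exact: delta_adj.
- exact: mem_adj_var.
move: dp; rewrite px0 raddf0 -/s => /esym/eqP; rewrite addrC addr_eq0 => /eqP.
by move=> dp; rewrite /derivatives iterS dp rpredN.
Qed.

Let red_delta_adj w : w \in K r.+1 -> reducible (delta w).
Proof.
move=> /delta_adj; apply: (adj_ind (L := reducible)) => //.
  by move=> v Tv; exact/redK/mem_adj_base.
move=> i; rewrite ltnS leq_eqVlt => /orP[/eqP->//|ir].
exact/redK/mem_adj_var.
Qed.

Let red_delta w : reducible w -> reducible (delta w).
Proof.
move=> [N]; set h := _ * w => hK.
have E : s ^+ N.+1 * delta w = s * delta h - h * delta s *+ N.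
  rewrite /h deltaM mulrDr mulrA deltaX mulrnAl [_ * delta s * w]mulrAC.
  by rewrite addrAC subrr add0r mulrA -exprS.
have [M] : reducible (s ^+ N.+1 * delta w).
  rewrite E; apply: redB.
    by apply: redM; [exact: redK|exact: red_delta_adj].
  (* [delta s *+ N] is the derivative of [s *+ N], which lies in [K r.+1]. *)
  rewrite -mulrnAr -raddfMn; apply: redM; first exact: redK.
  by apply: red_delta_adj; rewrite rpredMn.
by rewrite mulrA -exprD; exists (M + N.+1)%N.
Qed.

(** Ritt reduction with respect to a relation [p(x^(r)) = 0].  The elements that
    a power of the separant carries into [K r.+1] form a subring.  It contains
    [x^(r+1)] because of the derivative of the relation, hence the derivatives of
    the elements of [K r.+1], and hence it is stable under the derivation: it
    contains all the [x^(i)]. *)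
Lemma separant_reduction k w :
  w \in K k -> exists N, s ^+ N * w \in K r.+1.
Proof.
apply: (adj_ind (L := reducible)) => //.
  by move=> v Tv; exact/redK/mem_adj_base.
move=> i _; elim: i => [|i IH]; first exact/redK/mem_adj_var.
exact: red_delta.
Qed.

End Separant.
End Derivation.

(** * Algebraic and transcendental elements over a subring of a domain *)

Section Domain.
Variables (S : comNzRingType) (S_integral : GRing.integral_domain_axiom S).

Lemma integral_mul_neq0 (v w : S) : v != 0 -> w != 0 -> v * w != 0.
Proof.
by move=> v0 w0; apply/eqP => /S_integral; rewrite (negPf v0) (negPf w0).
Qed.

Lemma integral_exp_neq0 (v : S) n : v != 0 -> v ^+ n != 0.
Proof.
move=> v0; elim: n => [|n IH]; first exact: oner_neq0.
by rewrite exprS integral_mul_neq0.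
Qed.

Lemma integral_size_scale (c : S) (p : {poly S}) :
  c != 0 -> size (c *: p) = size p.
Proof.
move=> c0; apply: lreg_size; apply: mulrI0_lreg => w cw.
by apply/eqP; have := S_integral cw; rewrite (negPf c0).
Qed.

Definition transcendental (K : {pred S}) (x : S) :=
  forall q, q \is a polyOver K -> q.[x] = 0 -> q = 0.

Definition minimal_relation (K : {pred S}) (x : S) (p : {poly S}) :=
  [/\ p \is a polyOver K, p != 0, p.[x] = 0 &
    forall q, q \is a polyOver K -> q.[x] = 0 -> (size q < size p)%N -> q = 0].

Lemma minimal_relation_exists (K : {pred S}) (x : S) :
  ~ transcendental K x -> exists p, minimal_relation K x p.
Proof.
move=> alg; pose P n := `[< exists p, [/\ p \is a polyOver K, p != 0, p.[x] = 0
  & size p = n] >].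
have exP : exists n, P n.
  apply: contrapT => nP; apply: alg => q qK qx; apply: contrapT => /eqP q0.
  by apply: nP; exists (size q); apply/asboolP; exists q.
case: (ex_minnP exP) => n /asboolP[p [pK p0 px <-]] min_p.
exists p; split=> // q qK qx sq; apply/eqP; apply: contraTT sq => q0.
by rewrite -leqNgt; apply: min_p; apply/asboolP; exists q.
Qed.

Lemma minimal_relation_size (K : {pred S}) x p :
  minimal_relation K x p -> (1 < size p)%N.
Proof.
move=> [_ p0 px _]; rewrite ltnNge; apply: contra p0 => /size1_polyC E.
by move: px; rewrite E hornerC => ->.
Qed.

(** Over the fraction field of [K], [q] is invertible modulo [p]; here is a
    version without denominators.  Pseudo-division of [p] by [q] yields
    [u(x) q(x) + rho(x) = 0] with [rho] of lower degree than [q], so that an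
    inverse of [rho(x)] up to [K] gives one of [q(x)].  The process does not
    break down: if [rho(x) = 0] then [u(x) q(x) = 0], hence [u(x) = 0], and [u]
    would be a relation of lower degree than [p]. *)
Lemma algebraic_dvd (K : subringClosed S) (x : S) (p q : {poly S}) :
    minimal_relation K x p -> q \is a polyOver K -> q.[x] != 0 ->
  exists v, [/\ v \is a polyOver K, v.[x] * q.[x] \in K & v.[x] * q.[x] != 0].
Proof.
move=> [pK p0 px min_p].
pose good w := exists v, [/\ v \is a polyOver K, v.[x] * w \in K
  & v.[x] * w != 0].
have good_mul (u : {poly S}) w :
    u \is a polyOver K -> good (u.[x] * w) -> good w.
  move=> uK [v [vK vwK vw0]]; exists (v * u); rewrite hornerM -mulrA.
  by rewrite rpredM.
have lK (q' : {poly S}) : q' \is a polyOver K -> lead_coef q' \in K.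
  by move/polyOverP => q'K; rewrite lead_coefE.
have l0 (q' : {poly S}) N : q' != 0 -> lead_coef q' ^+ N != 0.
  by move=> q'0; rewrite integral_exp_neq0 ?lead_coef_eq0.
(* A first division by [p] makes the degree smaller than that of [p]. *)
suff small n : forall q' : {poly S}, (size q' <= n)%N -> (size q' < size p)%N ->
    q' \is a polyOver K -> q'.[x] != 0 -> good q'.[x].
  move=> qK qx; have [N [u [rho [uK rK E srho]]]] := pseudo_division p0 pK qK.
  have {}E : (lead_coef p ^+ N)%:P.[x] * q.[x] = rho.[x].
    by rewrite hornerC -hornerZ E !hornerE px mulr0 add0r.
  apply: (good_mul (lead_coef p ^+ N)%:P).
    by rewrite polyOverC rpredX ?lK.
  by rewrite E; apply: small => //; rewrite -E hornerC integral_mul_neq0 ?l0.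
elim: n => [|n IH] q' sq' sq'p q'K q'x.
  by move: sq' q'x; rewrite leqn0 size_poly_eq0 => /eqP->; rewrite horner0 eqxx.
have q'0 : q' != 0 by apply: contraNneq q'x => ->; rewrite horner0.
have [/size1_polyC q'c|sq'1] := leqP (size q') 1.
  exists 1; rewrite hornerC mul1r rpred1 q'x; split=> //.
  by rewrite q'c hornerC; move/polyOverP: q'K; apply.
have [N [u [rho [uK rK E srho]]]] := pseudo_division q'0 q'K pK.
have Ex : u.[x] * q'.[x] + rho.[x] = 0.
  by rewrite -hornerM -hornerD -E hornerZ px mulr0.
have [rx|rx] := eqVneq rho.[x] 0.
  have r0 : rho = 0 by apply: min_p => //; exact: ltn_trans sq'p.
  have ux : u.[x] = 0.
    move: Ex; rewrite rx addr0 => /S_integral; rewrite (negPf q'x) orbF.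
    by move/eqP.
  move: E; rewrite r0 addr0 => E.
  have u0 : u = 0.
    apply: min_p => //; have [->|u0] := eqVneq u 0.
      by rewrite size_poly0 size_poly_gt0.
    rewrite -(integral_size_scale p (l0 _ N q'0)) E size_proper_mul; last first.
      by rewrite integral_mul_neq0 ?lead_coef_eq0.
    rewrite -subn1 -addnBA ?(ltnW sq'1) // -[X in (X < _)%N]addn0.
    by rewrite ltn_add2l subn_gt0.
  move: E; rewrite u0 mul0r => /(congr1 (fun f : {poly S} => size f)).
  by rewrite integral_size_scale ?l0 // size_poly0 => /eqP;
    rewrite size_poly_eq0 (negPf p0).
apply: (good_mul (- u)); first by rewrite rpredN.
rewrite hornerN mulNr (_ : - _ = rho.[x]); last first.
  by apply/eqP; rewrite eq_sym -addr_eq0 addrC Ex.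
apply: IH => //; last exact: ltn_trans sq'p.
by rewrite -ltnS (leq_trans srho).
Qed.

End Domain.

(** * Graphs of ring morphisms and generic specializations *)

Section Graph.
Variables A S V : comNzRingType.
Implicit Types (iota : {rmorphism A -> S}) (phi : {rmorphism A -> V}).
Implicit Types (x : nat -> S) (y : nat -> V).

Definition range_of (W : comNzRingType) (f : A -> W) (w : W) :=
  exists a, w = f a.
Definition graph (f : A -> S) (g : A -> V) (w : S * V) :=
  exists a, w = (f a, g a).
Definition pairs x y (i : nat) : S * V := (x i, y i).

Lemma graph_fst iota phi x y k g :
  g \in adj (graph iota phi) (pairs x y) k -> g.1 \in adj (range_of iota) x k.
Proof.
apply: (@adj_map (S * V)%type S fst) => // _ [a ->].
by exists a.
Qed.

Lemma graph_snd iota phi x y k g :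
  g \in adj (graph iota phi) (pairs x y) k -> g.2 \in adj (range_of phi) y k.
Proof.
apply: (@adj_map (S * V)%type V snd) => // _ [a ->].
by exists a.
Qed.

Lemma graph_lift iota phi x y k s :
  s \in adj (range_of iota) x k ->
  exists2 g, g \in adj (graph iota phi) (pairs x y) k & g.1 = s.
Proof.
apply: (@adj_lift (S * V)%type S fst) => // _ [a ->].
by exists (iota a, phi a) => //; exists a.
Qed.

Lemma graph_base iota phi x y g :
  g \in adj (graph iota phi) (pairs x y) 0 -> graph iota phi g.
Proof.
apply: (adj_ind (L := graph iota phi)) => //.
- by exists 1; rewrite !rmorph1.
- by move=> _ _ [a ->] [b ->]; exists (a - b); rewrite !rmorphB.
- by move=> _ _ [a ->] [b ->]; exists (a * b); rewrite !rmorphM.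
Qed.

(** Independent elements may be sent anywhere: a polynomial in [x k] that vanishes
    has vanishing coefficients, and by induction these determine the
    coefficients above them in the graph. *)
Lemma graph_inj iota phi x y k :
    injective iota ->
    (forall i, (i < k)%N -> transcendental (adj (range_of iota) x i) (x i)) ->
  forall g, g \in adj (graph iota phi) (pairs x y) k -> g.1 = 0 -> g = 0.
Proof.
move=> inj_iota; elim: k => [|k IH] trx g.
  move=> /graph_base[a ->] /= a0; have -> : a = 0.
    by apply: inj_iota; rewrite a0 rmorph0.
  by rewrite !rmorph0.
move=> /adjSP[q qK ->] q1; suff -> : q = 0 by rewrite horner0.
have q1' : map_poly fst q = 0.
  apply: (trx k (ltnSn k)); last by rewrite (horner_map fst q (pairs x y k)).
  apply/polyOverP => i; rewrite coef_map; apply: graph_fst.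
  by move/polyOverP: qK; apply.
apply/polyP => i; rewrite coef0; apply: IH.
- by move=> j jk; apply: trx; rewrite ltnW.
- by move/polyOverP: qK; apply.
- by rewrite -[_.1](coef_map fst) q1' coef0.
Qed.

End Graph.

(** The element [a] is a coefficient of [D], seen as a polynomial in the [x i]:
    the leading coefficient in [x k.-1] of [D], then the leading coefficient of
    that in [x k.-2], and so on.  It depends neither on [phi] nor on the [y i],
    whose independence keeps the leading coefficients of the image leading. *)
Lemma generic_specialization (A S : comNzRingType) (iota : {rmorphism A -> S})
    (x : nat -> S) k :
    (forall i, (i < k)%N -> transcendental (adj (range_of iota) x i) (x i)) ->
  forall D, D \in adj (range_of iota) x k -> D != 0 ->
  exists2 a : A, a != 0 &
    forall (V : comNzRingType) (phi : {rmorphism A -> V}) (y : nat -> V),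
      (forall i, (i < k)%N -> transcendental (adj (range_of phi) y i) (y i)) ->
      injective iota -> phi a != 0 ->
      forall t, (D, t) \in adj (graph iota phi) (pairs x y) k -> t != 0.
Proof.
elim: k => [|k IH] trx D.
  move=> DK D0; have [a Da] : range_of iota D.
    move: DK; apply: (adj_ind (L := range_of iota)) => //.
    - by exists 1; rewrite rmorph1.
    - by move=> _ _ [a ->] [b ->]; exists (a - b); rewrite rmorphB.
    - by move=> _ _ [a ->] [b ->]; exists (a * b); rewrite rmorphM.
  exists a; first by apply: contraNneq D0 => a0; rewrite Da a0 rmorph0.
  move=> V phi y _ inj_iota phia t /graph_base[b [Db ->]].
  by have -> : b = a by apply: inj_iota; rewrite -Db.
move=> /adjSP[q qK ->] qx.
have q0 : q != 0 by apply: contraNneq qx => ->; rewrite horner0.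
have trx' i : (i < k)%N -> transcendental (adj (range_of iota) x i) (x i).
  by move=> ik; apply: trx; rewrite ltnW.
have lK : lead_coef q \in adj (range_of iota) x k.
  by rewrite lead_coefE; move/polyOverP: qK; apply.
have l0 : lead_coef q != 0 by rewrite lead_coef_eq0.
have [a a0 aP] := IH trx' _ lK l0; exists a => // V phi y tr_y inj_iota phia t.
move=> /adjSP[Q QK E].
have Q1 : map_poly fst Q = q.
  apply/eqP; rewrite -subr_eq0; apply/eqP; apply: (trx k (ltnSn k)).
    apply: rpredB => //; apply/polyOverP => i; rewrite coef_map.
    by apply: graph_fst; move/polyOverP: QK; apply.
  rewrite hornerD hornerN (horner_map fst Q (pairs x y k)) -E.
  exact: subrr.
have Q2 : map_poly snd Q != 0.
  apply/eqP => /(congr1 (fun f : {poly V} => f`_(size q).-1)).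
  rewrite coef_map coef0; apply/eqP; apply: (aP V phi y) => //.
    by move=> i ik; apply: tr_y; rewrite ltnW.
  rewrite lead_coefE -Q1 coef_map Q1 /=.
  by move/polyOverP: QK => /(_ (size q).-1); case: (Q`__).
apply: contraNneq Q2 => t0; apply/eqP/(tr_y k (ltnSn k)).
  apply/polyOverP => i; rewrite coef_map.
  by apply: graph_snd; move/polyOverP: QK; apply.
by rewrite (horner_map snd Q (pairs x y k)) -E.
Qed.

(** * Substitution and order in differential polynomials *)

Section MonomialPower.
Variables (R : comNzRingType) (v : nat -> R).

Definition monom_eval (m : {cmonom nat}) : R :=
  \prod_(k <- finsupp m) v k ^+ m k.

Lemma monom_evalEw (d : {fset nat}) (m : {cmonom nat}) :
  (finsupp m `<=` d)%fset -> monom_eval m = \prod_(k <- d) v k ^+ m k.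
Proof.
move=> le; apply: big_fset_incl => // k _.
by rewrite -cmE_neq0 negbK => /eqP->.
Qed.

Fact monom_eval_mmorphism : mmorphism monom_eval.
Proof.
split=> [m1 m2|]; last by rewrite /monom_eval mdom1 big_seq_fset0.
rewrite (monom_evalEw (m := m1) (fsubsetUl _ (finsupp m2))).
rewrite (monom_evalEw (m := m2) (fsubsetUr (finsupp m1) _)) /monom_eval mdomD.
by rewrite -big_split; apply: eq_bigr => k _; rewrite cmM exprD.
Qed.

HB.instance Definition _ :=
  monalg.isMultiplicative.Build {cmonom nat} R monom_eval monom_eval_mmorphism.
End MonomialPower.

Section DifferentialPolynomials.
Variable F : diffFieldType.
Local Notation M := {dpoly F}.

(** For [f] the identity and [v] the sequence of derivatives of [alpha], this is
    the value at [alpha]. *)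
Definition subst (R : comNzRingType) (f : {rmorphism F -> R}) (v : nat -> R)
    (A : M) : R := mmap f (monom_eval v) A.

HB.instance Definition _ (R : comNzRingType) (f : {rmorphism F -> R}) v :=
  GRing.RMorphism.copy (subst f v) (mmap f (monom_eval v)).

Definition yvar (k : nat) : M := << ucm k >>.

Lemma subst_yvar R f v k : @subst R f v (yvar k) = v k.
Proof.
by rewrite /subst mmapU [X in X * _](rmorph1 f) mul1r /monom_eval mdomU
  big_seq_fset1 cmUU.
Qed.

Lemma substC R f v c : @subst R f v c%:MP = f c.
Proof. exact: mmapC. Qed.

Lemma devalE (A : M) alpha : deval A alpha = subst idfun (derivatives alpha) A.
Proof. by []. Qed.

Section Order.
Variables (A : comNzRingType) (phi : {rmorphism A -> F}) (r : nat).
Local Notation M_ r := (adj (range_of (malgC \o phi : A -> M)) yvar r).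

Let split_const : {rmorphism F -> {poly M}} := polyC \o @malgC {cmonom nat} F.
(* Writes a differential polynomial as a polynomial in [y^(r)] whose coefficients
   involve the other variables only. *)
Let split : {rmorphism M -> {poly M}} :=
  subst split_const (fun k => if k == r then 'X else (yvar k)%:P).

(* The variables of [c] come before [y^(r)], so that [c] is a constant for
   [split]. *)
Let splitC c : c \in M_ r -> split c = c%:P.
Proof.
apply: (adj_ind (L := fun c => split c = c%:P)) => {c}.
- by move=> _ [a ->]; rewrite /split /= substC.
- by move=> i ir; rewrite /split /= subst_yvar ltn_eqF.
- by rewrite rmorph1.
- by move=> c d Ec Ed; rewrite rmorphB Ec Ed rmorphB.
- by move=> c d Ec Ed; rewrite rmorphM Ec Ed rmorphM.
Qed.

Let split_horner q : q \is a polyOver (M_ r) -> split q.[yvar r] = q.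
Proof.
move=> qM; rewrite -horner_map /split /= subst_yvar eqxx -[RHS]comp_polyXr.
congr (_.['X]); apply/polyP => i; rewrite !coef_map.
by apply: splitC; move/polyOverP: qM; apply.
Qed.

Lemma yvar_transcendental : transcendental (M_ r) (yvar r).
Proof. by move=> q qM q0; rewrite -[q]split_horner // q0 rmorph0. Qed.

Let bounded (B : M) :=
  forall m : {cmonom nat}, m \in msupp B ->
    forall i, i \in finsupp m -> (i < r)%N.

Let bounded_adj B : B \in M_ r -> bounded B.
Proof.
apply: (adj_ind (L := bounded)) => {B}.
- move=> _ [a ->] m /(fsubsetP (msuppC_le _)); rewrite inE => /eqP-> i.
  by rewrite mdom1 inE.
- move=> k kr m /(fsubsetP msuppU_le); rewrite inE => /eqP-> i.
  by rewrite mdomU inE => /eqP->.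
- move=> m /(fsubsetP (msuppC_le _)); rewrite inE => /eqP-> i.
  by rewrite mdom1 inE.
- move=> B C bB bC m /(fsubsetP (msuppB_le _ _)); rewrite inE.
  by case/orP; [exact: bB|exact: bC].
- move=> B C bB bC m /msuppM_le[m1 [m2 [m1B m2C ->]]] i.
  by rewrite mdomD inE => /orP[]; [exact: bB|exact: bC].
Qed.

Let bounded_split B : bounded B -> split B = (subst malgC yvar B)%:P.
Proof.
move=> bB; rewrite /split /= /subst !mmapE rmorph_sum.
apply: eq_big_seq => m mB.
rewrite rmorphM; congr (_ * _); rewrite /monom_eval rmorph_prod.
by apply: eq_big_seq => i /(bB m mB) ir; rewrite ltn_eqF // rmorphXn.
Qed.

(** If every variable of [q(y^(r))] came before [y^(r)], then [split] would send
    it to a constant; but it sends it to [q], of positive degree. *)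
Lemma dord_lt_horner B q :
    B \in M_ r -> q \is a polyOver (M_ r) -> (1 < size q)%N ->
  dord_lt (dord B) (dord q.[yvar r]).
Proof.
move=> /bounded_adj bB qM q1; set C := q.[_].
pose vars (D : M) :=
  [seq i | m : {cmonom nat} <- msupp D, i <- (finsupp m : seq nat)].
have varsP D : dord D = if vars D is [::] then None
  else Some (\max_(i <- vars D) i)%N by [].
have ltB : forall i, i \in vars B -> (i < r)%N.
  by move=> i /allpairsPdep[m [j [mB jm ->]]]; exact: bB jm.
have [i iC ri] : exists2 i, i \in vars C & (r <= i)%N.
  apply: contrapT => nC; suff bC : bounded C.
    have := bounded_split bC; rewrite split_horner // => Eq.
    by move: q1; rewrite Eq ltnNge size_polyC_leq1.
  move=> m mC i im; rewrite ltnNge; apply/negP => ri; apply: nC; exists i => //.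
  by apply/allpairsPdep; exists m, i.
have leC : (r <= \max_(i <- vars C) i)%N.
  by apply: leq_trans ri _; exact: leq_bigmax_seq.
rewrite !varsP; case: (vars C) iC leC => // j s _ leC.
case: (vars B) ltB => // k t ltB; apply: leq_trans leC.
have r0 : (0 < r)%N by apply: leq_trans (ltB k _); rewrite ?mem_head.
rewrite -(prednK r0) ltnS; apply/bigmax_leqP_seq => l lt _.
by rewrite -ltnS prednK // ltB.
Qed.

End Order.
End DifferentialPolynomials.

(** * Specialization of one differential generator *)

Section PairDerivation.
Variables S F : diffRingType.

Definition pair_delta (w : S * F) : S * F := (delta w.1, delta w.2).

Fact pair_deltaD : {morph pair_delta : v w / v + w}.
Proof. by move=> [a b] [c d]; congr (_, _); rewrite /= deltaD. Qed.

Fact pair_deltaM v w :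
  pair_delta (v * w) = pair_delta v * w + v * pair_delta w.
Proof. by case: v w => [a b] [c d]; congr (_, _); rewrite /= deltaM. Qed.

HB.instance Definition _ :=
  hasDerivation.Build (S * F)%type pair_deltaD pair_deltaM.

Lemma pair_derivatives (x : S) (alpha : F) i :
  derivatives (x, alpha) i = (derivatives x i, derivatives alpha i).
Proof. by elim: i => // i; rewrite /derivatives !iterS => ->. Qed.

End PairDerivation.

Section MapSnd.
Variables (S V W : comNzRingType) (h : {rmorphism V -> W}).

Definition map_snd (g : S * V) : S * W := (g.1, h g.2).

Fact map_snd_zmod : zmod_morphism map_snd.
Proof. by move=> [a b] [c d]; rewrite /map_snd /= rmorphB. Qed.

Fact map_snd_monoid : monoid_morphism map_snd.
Proof.
by split=> [|[a b] [c d]]; rewrite /map_snd /= ?rmorph1 ?rmorphM.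
Qed.

HB.instance Definition _ :=
  GRing.isZmodMorphism.Build (S * V)%type (S * W)%type map_snd map_snd_zmod.
HB.instance Definition _ :=
  GRing.isMonoidMorphism.Build (S * V)%type (S * W)%type map_snd map_snd_monoid.
End MapSnd.

Section Specialization.
Variables (A S : diffRingType) (iota : {rmorphism A -> S}) (x : S).
Hypotheses (S_integral : GRing.integral_domain_axiom S)
  (S_char0 : forall n, n.+1%:R != 0 :> S)
  (inj_iota : injective iota)
  (delta_iota : forall a, iota (delta a) = delta (iota a)).
Local Notation K := (adj (range_of iota) (derivatives x)).

Lemma delta_range w : range_of iota w -> range_of iota (delta w).
Proof. by move=> [a ->]; exists (delta a). Qed.

Section Target.
Variables (F : diffFieldType) (phi : {rmorphism A -> F}).
Hypothesis delta_phi : forall a, phi (delta a) = delta (phi a).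
Local Notation phiM := (malgC \o phi : A -> {dpoly F}).
Local Notation GM := (adj (graph iota phiM) (pairs (derivatives x) (@yvar F))).

Lemma delta_graph w : graph iota phi w -> graph iota phi (delta w).
Proof. by move=> [a ->]; exists (delta a); rewrite delta_iota delta_phi. Qed.

Section Value.
Variable alpha : F.
Definition value : {rmorphism {dpoly F} -> F} :=
  subst idfun (derivatives alpha).
Local Notation G := (adj (graph iota phi) (derivatives (x, alpha))).

Lemma value_adj k g : g \in GM k -> map_snd value g \in G k.
Proof.
apply: (@adj_map (S * {dpoly F})%type (S * F)%type (map_snd value)).
  by move=> _ [a ->]; exists a; rewrite /= /map_snd /= substC.
by move=> i; rewrite pair_derivatives /= /map_snd /= subst_yvar.
Qed.

Lemma value_lift k g : g \in G k -> exists2 h, h \in GM k & map_snd value h = g.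
Proof.
apply: (@adj_lift (S * {dpoly F})%type (S * F)%type (map_snd value)).
  move=> _ [a ->]; exists (iota a, phiM a); first by exists a.
  by rewrite /= /map_snd /= substC.
by move=> i; rewrite pair_derivatives /= /map_snd /= subst_yvar.
Qed.

(** Being closed under differences, the subring generated by the graph of [phi]
    and the derivatives of [(x, alpha)] is the graph of a function as soon as it
    is one above [0]. *)
Definition graph_functional :=
  forall k g, g \in G k -> g.1 = 0 -> g.2 = 0.

Definition graph_nonzero (b : S) := forall k t, (b, t) \in G k -> t != 0.

Lemma value_inj k :
    (forall i, (i < k)%N -> transcendental (K i) (derivatives x i)) ->
  forall g, g \in G k -> g.1 = 0 -> g = 0.
Proof.
move=> trx g /value_lift[h hG <-] h1.
by rewrite (graph_inj inj_iota trx hG h1) rmorph0.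
Qed.

Lemma graph_functional_eq k l b t u :
  graph_functional -> (b, t) \in G k -> (b, u) \in G l -> t = u.
Proof.
move=> funG btG buG; apply/eqP; rewrite -subr_eq0; apply/eqP.
apply: (funG (maxn k l) ((b, t) - (b, u))); last exact: subrr.
apply: rpredB; [apply: adj_le btG | apply: adj_le buG].
  exact: leq_maxl.
exact: leq_maxr.
Qed.

End Value.

(** If the [x^(i)] are independent then [R{x}] is a ring of differential
    polynomials, and any [alpha] defines an extension.  In order to avoid the
    zeros of the image [t] of [b], closedness is used with the equation
    [y^(k) = 0], whose order exceeds that of [t]. *)
Lemma transcendental_step (F_closed : differentially_closed F) k (b : S) :
    (forall i, transcendental (K i) (derivatives x i)) ->
    b \in K k -> (forall t, (b, t) \in GM k -> t != 0) ->
  exists alpha, graph_functional alpha /\ graph_nonzero alpha b.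
Proof.
move=> trx bK bP; have [[b' t] btG /= Eb] := graph_lift phiM (@yvar F) bK.
move: btG; rewrite {b'}Eb => btG.
have t0 := bP t btG.
have := graph_snd btG; rewrite /= => tM.
have [alpha [_ ta]] : exists alpha,
    deval (yvar F k) alpha = 0 /\ deval t alpha != 0.
  apply: F_closed => //; rewrite -[yvar F k]hornerX.
  by apply: dord_lt_horner tM _ _; rewrite ?polyOverX ?size_polyX.
have funG : graph_functional alpha.
  by move=> l g gG g1; rewrite (value_inj (k := l) _ gG g1).
exists alpha; split=> // l u buG.
by rewrite (graph_functional_eq funG buG (value_adj alpha btG)).
Qed.

(** The relation [p] is lifted to [P] over the graph in [S * F{y}], whose second
    component is the differential polynomial that [alpha] annihilates; [Q] is
    the specialization of [P] at [alpha], a relation for [(x, alpha)].  The pairs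
    [c] and [d] lie above multiples in [K r] of the separant and of [b]; their
    values at [alpha], which are not zero, certify that neither the separant nor
    [b] specializes to zero. *)
Section AlgebraicStep.
Variables (r : nat) (p : {poly S}).
Hypotheses (trx : forall i, (i < r)%N -> transcendental (K i) (derivatives x i))
  (min_p : minimal_relation (K r) (derivatives x r) p).
Variables (P : {poly S * {dpoly F}}) (alpha : F).
Hypotheses (PG : P \is a polyOver (GM r)) (P_fst : map_poly fst P = p)
  (lead_alpha : value alpha (P`_(size p).-1).2 != 0)
  (root_alpha : value alpha (map_poly snd P).[yvar F r] = 0).
Local Notation G := (adj (graph iota phi) (derivatives (x, alpha))).
Local Notation xr := (derivatives (x, alpha) r).
Let Q : {poly S * F} := map_poly (map_snd (value alpha)) P.

Let xrE : xr = (derivatives x r, derivatives alpha r).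
Proof. exact: pair_derivatives. Qed.

Let QG : Q \is a polyOver (G r).
Proof.
apply/polyOverP => i; rewrite coef_map; apply: value_adj.
by move/polyOverP: PG; apply.
Qed.

Let Q_fst : map_poly fst Q = p.
Proof. by rewrite -P_fst; apply/polyP => i; rewrite !coef_map. Qed.

Let Q_root : Q.[xr] = 0.
Proof.
have -> : xr = map_snd (value alpha) (derivatives x r, yvar F r).
  by rewrite xrE /= /map_snd /= subst_yvar.
have p0 : p.[derivatives x r] = 0 by case: min_p.
rewrite horner_map /= /map_snd; congr (_, _).
  by rewrite -(horner_map fst) P_fst.
by rewrite -(horner_map snd) root_alpha.
Qed.

Let size_Q : size Q = size p.
Proof.
apply/eqP; rewrite eqn_leq; apply/andP; split.
  apply/leq_sizeP => i le_i; apply: (value_inj (alpha := alpha) (k := r) trx).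
    by move/polyOverP: QG; apply.
  by rewrite -[_.1](coef_map fst) Q_fst nth_default.
by rewrite -Q_fst map_polyE (leq_trans (size_Poly _)) ?size_map.
Qed.

Let Q_lead : (lead_coef Q).2 != 0.
Proof. by rewrite lead_coefE size_Q coef_map. Qed.

Let Q_neq0 : Q != 0.
Proof. by apply: contraNneq Q_lead => ->; rewrite lead_coef0. Qed.

Let G_fst k g : g \in G k -> g.1 \in K k.
Proof.
apply: (@adj_map (S * F)%type S fst); first by move=> _ [a ->]; exists a.
by move=> j; rewrite pair_derivatives.
Qed.

(* Multiplied by a power of the leading coefficient of [Q], [g] becomes the
   value of a polynomial [rho] of lower degree than [p]; minimality of [p] makes
   the first components of the coefficients of [rho] vanish, and these
   components determine the coefficients. *)
Let functional_next g : g \in G r.+1 -> g.1 = 0 -> g.2 = 0.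
Proof.
move=> /adjSP[q qG Eg] g1.
have [N [u [rho [uG rG E srho]]]] := pseudo_division Q_neq0 QG qG.
have {}E : lead_coef Q ^+ N * g = rho.[xr].
  by rewrite Eg -hornerZ E !hornerE Q_root mulr0 add0r.
have rho_fst : map_poly fst rho = 0.
  have [_ _ _ min] := min_p; apply: min.
  - apply/polyOverP => i; rewrite coef_map.
    by apply: G_fst; move/polyOverP: rG; apply.
  - by rewrite -[derivatives x r]/((derivatives x r, derivatives alpha r).1)
      -xrE (horner_map fst) -E /= g1 mulr0.
  - apply: leq_ltn_trans (_ : _ <= size rho)%N _; last by rewrite -size_Q.
    by rewrite map_polyE (leq_trans (size_Poly _)) ?size_map.
have rho0 : rho = 0.
  apply/polyP => i; rewrite coef0.
  apply: (value_inj (alpha := alpha) (k := r) trx).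
    by move/polyOverP: rG; apply.
  by rewrite -[_.1](coef_map fst) rho_fst coef0.
move: E; rewrite rho0 horner0 => /(congr1 snd)/eqP.
rewrite rmorphM rmorphXn /= mulf_eq0 expf_eq0 (negPf Q_lead) andbF /=.
by move/eqP.
Qed.

Variables (N : nat) (b v w : S) (c d : S * {dpoly F}).
Let sep := p^`().[derivatives x r].
Hypotheses (vK : v \in K r.+1) (cG : c \in GM r) (c_fst : c.1 = v * sep)
  (c_alpha : value alpha c.2 != 0).
Hypotheses (wK : w \in K r.+1) (dG : d \in GM r)
  (d_fst : d.1 = w * (sep ^+ N * b)) (d_alpha : value alpha d.2 != 0).

Let Sep := Q^`().[xr].

Let Sep_fst : Sep.1 = sep.
Proof.
by rewrite /Sep -[LHS](horner_map fst) -deriv_map Q_fst xrE.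
Qed.

Let G_lift k s : s \in K k -> exists2 g, g \in G k & g.1 = s.
Proof.
move=> /(graph_lift phiM (@yvar F))[g /value_adj gG <-].
by exists (map_snd (value alpha) g).
Qed.

Let SepG : Sep \in G r.+1.
Proof.
apply: rpred_horner; last exact: mem_adj_var.
apply: (polyOverS (adj_le (leqnSn r))); exact: polyOver_deriv.
Qed.

Let Sep_snd : Sep.2 != 0.
Proof.
have [v' v'G v'1] := G_lift vK.
have : (v' * Sep - map_snd (value alpha) c).2 = 0.
  apply: functional_next; last first.
    by rewrite rmorphB rmorphM /= v'1 Sep_fst c_fst subrr.
  by rewrite rpredB ?rpredM // (adj_le (leqnSn r)) ?value_adj.
move/eqP; rewrite rmorphB rmorphM /= subr_eq0 => /eqP E.
by move: c_alpha; rewrite /= -E mulf_eq0 negb_or => /andP[].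
Qed.

Let functional : graph_functional alpha.
Proof.
move=> k g gG g1.
have [M MG] := separant_reduction delta_graph QG Q_root gG.
have /eqP : (Sep ^+ M * g).2 = 0.
  by apply: functional_next => //; rewrite rmorphM /= g1 mulr0.
rewrite rmorphM rmorphXn /= mulf_eq0 expf_eq0 (negPf Sep_snd) andbF /=.
by move/eqP.
Qed.

Lemma algebraic_step : graph_functional alpha /\ graph_nonzero alpha b.
Proof.
split=> // k t btG; have [w' w'G w'1] := G_lift wK.
have /eqP : (w' * (Sep ^+ N * (b, t)) - map_snd (value alpha) d).2 = 0.
  apply: (functional (k := maxn r.+1 k)).
    apply: rpredB; last first.
      by apply: adj_le (value_adj alpha dG); rewrite leq_max leqnSn.
    apply: rpredM; first by apply: adj_le w'G; rewrite leq_maxl.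
    apply: rpredM; last by apply: adj_le btG; rewrite leq_maxr.
    by apply: rpredX; apply: adj_le SepG; rewrite leq_maxl.
  by rewrite rmorphB !rmorphM rmorphXn /= w'1 Sep_fst d_fst subrr.
rewrite rmorphB !rmorphM rmorphXn /= subr_eq0 => /eqP E.
by move: d_alpha; rewrite /= -E !mulf_eq0 !negb_or => /and3P[].
Qed.

End AlgebraicStep.
End Target.

Lemma separant_neq0 (K' : subringClosed S) z p :
  minimal_relation K' z p -> p^`().[z] != 0.
Proof.
move=> min_p; have sp := minimal_relation_size min_p.
have [pK p0 _ min] := min_p.
apply/eqP => /min; rewrite polyOver_deriv // lt_size_deriv // => /(_ isT isT).
move=> /(congr1 (fun q : {poly S} => q`_(size p).-2)).
rewrite coef_deriv coef0 prednK ?ltn_predRL // -lead_coefE -mulr_natr.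
case: (size p) sp => [|[|n]] //= _ /eqP; apply/negP.
by apply: integral_mul_neq0; rewrite ?lead_coef_eq0.
Qed.

Lemma adj_dvd r p :
    minimal_relation (K r) (derivatives x r) p ->
  forall c, c \in K r.+1 -> c != 0 ->
    exists2 v, v \in K r.+1 & v * c \in K r /\ v * c != 0.
Proof.
move=> min_p _ /adjSP[q qK ->] qx.
have [v [vK vqK vq0]] := algebraic_dvd S_integral min_p qK qx.
exists v.[derivatives x r] => //.
apply: rpred_horner; last exact: mem_adj_var.
exact: (polyOverS (adj_le (leqnSn r))).
Qed.

(** The element [a] is obtained from [b] itself when [x] is differentially
    transcendental, and otherwise from the product of the leading coefficient of
    [p] and of multiples in [K r] of the separant and of [b] (up to a power of
    the separant), so that a single non-vanishing controls all three. *)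
Theorem one_variable_specialization k b : b \in K k -> b != 0 ->
  exists2 a : A, a != 0 &
    forall (F : diffFieldType) (phi : {rmorphism A -> F}),
      differentially_closed F -> (forall a, phi (delta a) = delta (phi a)) ->
      phi a != 0 ->
      exists alpha, graph_functional phi alpha /\ graph_nonzero phi alpha b.
Proof.
move=> bK b0.
have [trx|alg] := pselect (forall i, transcendental (K i) (derivatives x i)).
  have [//|a a0 aP] := generic_specialization (k := k) _ bK b0.
  exists a => // F phi F_closed delta_phi phia.
  apply: (transcendental_step F_closed trx bK) => t.
  apply: aP => //; first by move=> i _; exact: yvar_transcendental.
  by rewrite /= -malgC0E malgC_eq.
have [r [trx /minimal_relation_exists[p min_p]]] : exists r,
    (forall i, (i < r)%N -> transcendental (K i) (derivatives x i))
    /\ ~ transcendental (K r) (derivatives x r).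
  pose Q i := `[< ~ transcendental (K i) (derivatives x i) >].
  have exQ : exists i, Q i.
    by apply: contrapT => nQ; apply: alg => i; apply: contrapT => ni; apply: nQ;
      exists i; apply/asboolP.
  case: (ex_minnP exQ) => r /asboolP nr min_r; exists r; split=> // i ir.
  by apply: contrapT => /asboolP/min_r; rewrite leqNgt ir.
have s0 := separant_neq0 min_p.
have [pK p0 px min] := min_p.
have sK : p^`().[derivatives x r] \in K r.+1.
  apply: rpred_horner; last exact: mem_adj_var.
  apply: (polyOverS (adj_le (leqnSn r))); exact: polyOver_deriv.
have [N NK] := separant_reduction delta_range pK px bK.
have [v vK [cK c0]] := adj_dvd min_p sK s0.
have [|w wK [dK d0]] := adj_dvd min_p NK.
  by rewrite integral_mul_neq0 ?integral_exp_neq0.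
set c := v * _ in cK c0; set d := w * _ in dK d0.
have lK : lead_coef p \in K r by rewrite lead_coefE; move/polyOverP: pK; apply.
have [||a a0 aP] := @generic_specialization A S iota (derivatives x) r trx
    (lead_coef p * c * d).
- by apply: rpredM => //; apply: rpredM.
- by do 2!apply: integral_mul_neq0 => //; rewrite lead_coef_eq0.
exists a => // F phi F_closed delta_phi phia.
pose phiM : {rmorphism A -> {dpoly F}} := malgC \o phi.
have lift := @polyOver_lift (S * {dpoly F})%type S fst
  (adj (graph iota phiM) (pairs (derivatives x) (@yvar F)) r) (K r)
  (@graph_lift _ _ _ iota phiM (derivatives x) (@yvar F) r).
have [P PG P_fst] := lift p pK.
have [c' c'G c'1] := graph_lift phiM (@yvar F) cK.
have [d' d'G d'1] := graph_lift phiM (@yvar F) dK.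
have PdG : P`_(size p).-1
    \in adj (graph iota phiM) (pairs (derivatives x) (@yvar F)) r.
  by move/polyOverP: PG; apply.
pose t := (P`_(size p).-1 * c' * d').2.
have tG : (lead_coef p * c * d, t)
    \in adj (graph iota phiM) (pairs (derivatives x) (@yvar F)) r.
  suff <- : P`_(size p).-1 * c' * d' = (lead_coef p * c * d, t).
    by rewrite !rpredM.
  rewrite [LHS]surjective_pairing; congr (_, _).
  by rewrite !rmorphM /= c'1 d'1 -[_.1](coef_map fst) P_fst lead_coefE.
have t0 : t != 0.
  apply: (aP _ phiM (@yvar F)) tG => //.
    by move=> i _; exact: yvar_transcendental.
  by rewrite /= -malgC0E malgC_eq.
have tM := graph_snd tG.
have P2 : map_poly snd P \is a polyOver (adj (range_of phiM) (@yvar F) r).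
  apply/polyOverP => i; rewrite coef_map.
  by apply: graph_snd; move/polyOverP: PG; apply.
have P2_size : (1 < size (map_poly snd P))%N.
  rewrite ltnNge; apply: contra t0 => le1.
  rewrite /t !rmorphM /= -[(P`_ _).2](coef_map snd) nth_default ?mul0r //.
  apply: leq_trans le1 _; have := minimal_relation_size min_p.
  by case: (size p) => [|[|]].
have [alpha [Palpha talpha]] := F_closed _ _ t0 (dord_lt_horner tM P2 P2_size).
exists alpha; move: talpha; rewrite devalE /t !rmorphM /= !mulf_eq0 !negb_or.
move=> /andP[/andP[P_alpha c_alpha] d_alpha].
exact: (algebraic_step delta_phi trx min_p PG P_fst P_alpha Palpha vK c'G c'1
  c_alpha wK d'G d'1 d_alpha).
Qed.

End Specialization.

(** * Extension of differential homomorphisms *)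

Section Adjoin.
Variables (S : diffAlgQType) (R : diffSubalg S) (x : S).
Local Notation K := (adj (range_of (val : dsub R -> S)) (derivatives x)).

Definition adjoin : {pred S} := fun s => `[< exists k, s \in K k >].

Lemma adjoinP s : reflect (exists k, s \in K k) (s \in adjoin).
Proof. exact: asboolP. Qed.

Lemma mem_adjoin_base s : s \in R -> s \in adjoin.
Proof.
move=> sR; apply/adjoinP; exists 0%N; apply: mem_adj_base.
by exists (Sub s sR); rewrite SubK.
Qed.

Lemma mem_adjoin_derivative k : iter k delta x \in adjoin.
Proof. by apply/adjoinP; exists k.+1; exact: mem_adj_var. Qed.

Lemma adjoin_common s t :
  s \in adjoin -> t \in adjoin -> exists k, s \in K k /\ t \in K k.
Proof.
move=> /adjoinP[j sK] /adjoinP[k tK]; exists (maxn j k).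
by split; [apply: adj_le sK; exact: leq_maxl|apply: adj_le tK; exact: leq_maxr].
Qed.

Fact adjoin_subalg_closed : subalg_closed adjoin.
Proof.
split=> [|c s t sK tK|s t sK tK].
- by apply: mem_adjoin_base; exact: rpred1.
- have cK : c *: 1 \in adjoin by apply: mem_adjoin_base; rewrite rpredZ ?rpred1.
  have [k [csK tK']] : exists k, c *: s \in K k /\ t \in K k.
    apply: adjoin_common => //; have [k [cK' sK']] := adjoin_common cK sK.
    by apply/adjoinP; exists k; rewrite -[s]mul1r scalerAl rpredM.
  by apply/adjoinP; exists k; exact: rpredD.
- have [k [sK' tK']] := adjoin_common sK tK.
  by apply/adjoinP; exists k; exact: rpredM.
Qed.

HB.instance Definition _ := GRing.isSubalgClosed.Build rat S adjoin
  adjoin_subalg_closed.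

Lemma delta_val_range w :
  range_of (val : dsub R -> S) w -> range_of (val : dsub R -> S) (delta w).
Proof. by move=> [a ->]; exists (delta a). Qed.

Fact adjoin_delta_closed : {in adjoin, forall s, delta s \in adjoin}.
Proof.
move=> s /adjoinP[k sK]; apply/adjoinP; exists k.+1.
exact: delta_adj delta_val_range _ _ sK.
Qed.

HB.instance Definition _ := isDeltaClosed.Build S adjoin adjoin_delta_closed.

End Adjoin.

Lemma diff_hom_rmorphism (A : diffAlgQType) (F : diffFieldType) (f : A -> F) :
  diff_hom f -> exists g : {rmorphism A -> F}, f = g.
Proof.
move=> [fD fM _ _].
have fB : zmod_morphism f.
  have f0 : f 0 = 0 by apply: (addrI (f 0)); rewrite -fD !addr0.
  by move=> s t; apply: (addIr (f t)); rewrite -fD !subrK.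
pose fA := GRing.isZmodMorphism.Build A F f fB.
pose fR := GRing.isMonoidMorphism.Build A F f fM.
pose g : {rmorphism A -> F} := HB.pack f fA fR.
by exists g.
Qed.

Section OneGenerator.
Variables (S : diffAlgQType) (S_integral : GRing.integral_domain_axiom S).

Lemma rat_algebra_char0 n : n.+1%:R != 0 :> S.
Proof.
apply/eqP => n0; have /eqP := oner_neq0 S; apply.
rewrite -[1]scale1r -(@mulVf rat n.+1%:R) ?Num.Theory.pnatr_eq0 //.
by rewrite -scalerA scaler_nat n0 scaler0.
Qed.

Lemma extend_to_adjoin (R : diffSubalg S) (x : S) (b : dsub (adjoin R x))
    (F : diffFieldType) (F_closed : differentially_closed F) : b != 0 ->
  exists a : dsub R, a != 0 /\
    forall phi : dsub R -> F, diff_hom phi -> phi a != 0 ->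
      exists psi : dsub (adjoin R x) -> F,
        [/\ diff_hom psi,
            forall (r : dsub R) (s : dsub (adjoin R x)),
              val s = val r -> psi s = phi r
          & psi b != 0].
Proof.
move=> b0; pose iota : {rmorphism dsub R -> S} := val.
have [kb bK] := adjoinP _ _ _ (valP b).
have [|a a0 aP] := @one_variable_specialization (dsub R) S iota x S_integral
  rat_algebra_char0 val_inj (fun _ => erefl) kb (val b) bK.
  by apply: contraNneq b0 => vb; apply/eqP/val_inj.
exists a; split=> // f f_hom fa; have [phi Ef] := diff_hom_rmorphism f_hom.
have [_ _ f_lin f_delta] := f_hom; rewrite {f f_hom}Ef in f_lin f_delta fa *.
have [alpha [funG nzG]] := aP F phi F_closed f_delta fa.
set G := fun k => adj (graph iota phi) (derivatives (x, alpha)) k.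
have total (s : dsub (adjoin R x)) : exists t, exists k, (val s, t) \in G k.
  have [k sK] := adjoinP _ _ _ (valP s).
  have [g gG Eg] := graph_lift phi (derivatives alpha) sK.
  exists g.2, k; rewrite -Eg -surjective_pairing /G.
  suff <- : pairs (derivatives x) (derivatives alpha) = derivatives (x, alpha).
    by [].
  by apply/funext => i; rewrite pair_derivatives.
have [psi psiP] := choice total.
have psiE s t k : (val s, t) \in G k -> psi s = t.
  by have [l pG] := psiP s; apply: graph_functional_eq funG pG.
have phiG r : (val r, phi r) \in G 0%N.
  by apply: mem_adj_base; exists r.
have common s s' : exists k, (val s, psi s) \in G k /\ (val s', psi s') \in G k.
  have [[j sG] [k sG']] := (psiP s, psiP s'); exists (maxn j k).
  split; first by apply: adj_le sG; exact: leq_maxl.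
  by apply: adj_le sG'; exact: leq_maxr.
have psi_phi r s : val s = val r -> psi s = phi r.
  by move=> sr; apply: (psiE _ _ 0%N); rewrite sr.
have psiM s s' : psi (s * s') = psi s * psi s'.
  have [k [sG s'G]] := common s s'; apply: (psiE _ _ k).
  exact: (rpredM sG s'G).
exists psi; split=> //.
- split=> //.
  + move=> s s'; have [k [sG s'G]] := common s s'; apply: (psiE _ _ k).
    exact: (rpredD sG s'G).
  + by split=> //; rewrite (psi_phi 1 1) // rmorph1.
  + move=> q s; have -> : q *: s = (q *: 1) * s by rewrite -scalerAl mul1r.
    (* The scalar [q *: 1] belongs to [R], where [phi] is known. *)
    rewrite psiM; congr (_ * _).
    by rewrite (psi_phi (q *: 1)) // f_lin rmorph1 mulr1.
  + move=> s; have [k sG] := psiP s; apply: (psiE _ _ k.+1).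
    apply: (@delta_adj _ _ (x, alpha)) sG.
    exact: delta_graph.
- have [k bG] := psiP b; exact: nzG bG.
Qed.

End OneGenerator.

Lemma subalg_gen_mono (k : pzRingType) (A : algType k) (X Y : A -> Prop) s :
  (forall t, X t -> subalg_gen Y t) -> subalg_gen X s -> subalg_gen Y s.
Proof.
move=> XY; elim=> [t /XY //||c t u _ Yt _ Yu|t u _ Yt _ Yu].
- exact: subalg_gen_one.
- exact: subalg_gen_lin.
- exact: subalg_gen_mul.
Qed.

Theorem theorem1 (S : diffAlgQType) (S_integral : GRing.integral_domain_axiom S)
    (b : S) (b_neq0 : b != 0)
    (R : diffSubalg S) (S_fingen : diff_finitely_generated R)
    (F : diffFieldType) (F_char0 : [pchar F] =i pred0)
    (F_closed : differentially_closed F) :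
  exists a : dsub R, a != 0 /\
    forall phi : dsub R -> F, diff_hom phi -> phi a != 0 ->
      exists psi : S -> F,
        [/\ diff_hom psi,
            forall x : dsub R, psi (val x) = phi x
          & psi b != 0].
Proof.
have [n [x gen]] := S_fingen.
elim: n R x gen {S_fingen} => [|n IH] R x gen.
  have SR s : s \in R.
    elim: (gen s) => [t [//|[[]]//]||c t u _ tR _ uR|t u _ tR _ uR].
    - exact: rpred1.
    - by rewrite rpredD ?rpredZ.
    - exact: rpredM.
  pose sub s : dsub R := Sub s (SR s).
  exists (sub b); split.
    by apply: contraNneq b_neq0 => /(congr1 val) /= ->.
  move=> phi [phiD phiM phi_lin phi_delta] phib; exists (phi \o sub).
  have sub_val r : sub (val r) = r by apply: val_inj.
  split=> // [|r]; last by rewrite /= sub_val.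
  split=> [s t||q s|s] /=.
  - by rewrite -phiD; congr phi; exact: val_inj.
  - split=> [|s t] /=; first by rewrite -phiM.1; congr phi; exact: val_inj.
    by rewrite -phiM.2; congr phi; exact: val_inj.
  - by rewrite -phi_lin; congr phi; exact: val_inj.
  - by rewrite -phi_delta; congr phi; exact: val_inj.
pose R1 : diffSubalg S := adjoin R (x ord0).
have [s|a1 [a1_neq0 a1P]] := IH R1 (fun i => x (lift ord0 i)).
  apply: subalg_gen_mono (gen s) => t [tR|[i [k ->]]]; apply: subalg_gen_mem.
    by left; exact: mem_adjoin_base.
  have [j ->|->] := unliftP ord0 i; first by right; exists j, k.
  by left; exact: mem_adjoin_derivative.
have [a [a_neq0 aP]] := extend_to_adjoin S_integral F_closed a1_neq0.
exists a; split=> // phi phi_hom phia.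
have [psi1 [psi1_hom psi1E psi1a1]] := aP phi phi_hom phia.
have [psi [psi_hom psiE psib]] := a1P psi1 psi1_hom psi1a1.
exists psi; split=> // r.
have rR1 : val r \in R1 by apply/mem_adjoin_base/valP.
by rewrite -(psi1E r (Sub (val r) rR1)) // -psiE SubK.
Qed.
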